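(* Let $R\ge2$ and let $\mathcal{T}=\mathrm{DEDICOM}(A,F,G)\in\mathbb{R}^{R\times R\times K}$ with $A\in\mathbb{R}^{R\times R}$, $F\in\mathbb{R}^{R\times R}$ symmetric, $G\in\mathbb{R}^{R\times K}$. Assume that (i) $\operatorname{rank}A=R$; (ii) $F$ has no zero entries; (iii) $\operatorname{rank}(G\odot G\odot G\odot G)=\binom{R+3}{4}$. Let $N=\frac{R^2(R-1)(R+1)}{12}$, let $p_1,\ldots,p_N$ be any basis of $\sigma_{(2,2)}(\operatorname{lker}\Phi(\mathcal{T}))$ (which has dimension $N$), let $P_n\in\mathbb{R}^{R^3\times R}$ be the $(R^3,R)$-matricization of $\sigma_4(p_n)$, i.e. $\mathrm{vec}(P_n)=\sigma_4(p_n)$, and let $$P_{sym}=\begin{bmatrix}P_1&\cdots&P_N\end{bmatrix}.$$ Then $\operatorname{rank}P_{sym}\le\binom{R+2}{3}-R$, and equality holds if and only if $\operatorname{krank}(F)\ge2$ and $\operatorname{krank}(F^{\top})\ge2$. In the latter case, $$\sigma_3(\operatorname{lker}P_{sym})=\operatorname{Span}\{a_1\boxtimes a_1\boxtimes a_1,\ldots,a_R\boxtimes a_R\boxtimes a_R\}=\operatorname{range}(A\odot A\odot A),$$ where $a_k$ are the columns of $A$.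
   Context: All matrices and tensors are real. $\mathrm{DEDICOM}(A,F,G)$ (fully symmetric ParaTuck-2 decomposition) denotes the tensor with frontal slices $\mathcal{T}_{:,:,k}=A\,\mathrm{Diag}(g_k)\,F\,\mathrm{Diag}(g_k)\,A^{\top}$, $k=1,\ldots,K$, where $g_k$ is the $k$-th column of $G$ and $F$ is symmetric. $\mathrm{vec}$ is column-major vectorization, $\boxtimes$ the Kronecker product, $\odot$ the Khatri–Rao (columnwise Kronecker) product. $\operatorname{krank}(Z)$ is the Kruskal rank: the largest $k$ such that every $k$ columns of $Z$ are linearly independent. $\operatorname{lker}Z=\{v:v^{\top}Z=0\}$. $\Phi(\mathcal{T})\in\mathbb{R}^{R^4\times K}$ is the matrix whose $k$-th column is $\mathrm{vec}(\mathcal{T}_{:,:,k})\boxtimes\mathrm{vec}(\mathcal{T}_{:,:,k})$. For any $n,d$, $\sigma_d:\mathbb{R}^{n^d}\to\mathbb{R}^{n^d}$ is the linear full symmetrization of a vectorized order-$d$ tensor: $\sigma_d(x_1\boxtimes\cdots\boxtimes x_d)=\frac1{d!}\sum_{\tau}x_{\tau(1)}\boxtimes\cdots\boxtimes x_{\tau(d)}$, sum over all permutations $\tau$ of $\{1,\dots,d\}$, $x_i\in\mathbb{R}^n$. $\sigma_{(2,2)}:\mathbb{R}^{R^4}\to\mathbb{R}^{R^4}$ is the linear map determined by $\sigma_{(2,2)}(z\boxtimes y\boxtimes b\boxtimes a)=\sigma_2\big(\sigma_2(z\boxtimes y)\boxtimes\sigma_2(b\boxtimes a)\big)$ for $z,y,b,a\in\mathbb{R}^R$,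 where the inner $\sigma_2$ act on $\mathbb{R}^{R^2}$ (with $n=R$) and the outer one on $\mathbb{R}^{R^4}$ (with $n=R^2$). The image of a subspace $\mathcal{V}$ under such a map $\sigma$ is denoted $\sigma(\mathcal{V})$. *)

(* Defs.v *)
From HB Require Import structures.
From mathcomp Require Import all_boot all_order all_fingroup all_algebra.
From mathcomp Require Import mxtens.
From mathcomp Require boolp.

Set Implicit Arguments.
Unset Strict Implicit.
Unset Printing Implicit Defensive.

Import GRing.Theory.
Local Open Scope ring_scope.

(* Conventions.  Third-order tensors are given by their frontal slices.
   Iterated Kronecker and Khatri-Rao products are bracketed to the right, so
   that n ^ d and the dimension of a d-fold product are convertible for every
   literal d > 0 (n ^ 4 is n * (n * (n * n))).  Subspaces are spaces of column
   vectors, of type {vspace 'cV_m}. *)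

Section Vectorization.
Variables (F : fieldType).

(* In a Kronecker product index the first factor is the most significant one,
   so stacking the columns of A puts A i j at index (j, i). *)
Definition vec m n (A : 'M[F]_(m, n)) : 'cV[F]_(n * m) :=
  \col_k A (mxtens_unindex k).2 (mxtens_unindex k).1.

Lemma vec_outer m n (x : 'cV[F]_m) (y : 'cV[F]_n) : vec (x *m y^T) = y *t x.
Proof.
apply/colP => k; rewrite !mxE big_ord1 mxE mulrC.
by congr (y _ _ * x _ _); apply: val_inj.
Qed.

Definition khatri_rao m n k (A : 'M[F]_(m, k)) (B : 'M[F]_(n, k)) :
    'M[F]_(m * n, k) :=
  \matrix_(i, j) (col j A *t col j B : 'cV_(m * n)) i ord0.

Fixpoint kron_rec n d : ('I_d.+1 -> 'cV[F]_n) -> 'cV[F]_(n ^ d.+1) :=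
  match d with
  | 0 => fun x => x ord0
  | d'.+1 => fun x => x ord0 *t kron_rec (fun t => x (lift ord0 t))
  end.

Definition kron n d : ('I_d -> 'cV[F]_n) -> 'cV[F]_(n ^ d) :=
  match d with
  | 0 => fun _ => const_mx 1
  | d'.+1 => @kron_rec n d'
  end.

End Vectorization.

Notation "A '\odot' B" := (khatri_rao A B)
  (at level 38, right associativity, format "A  '\odot'  B") : ring_scope.

Section Spaces.
Variables (F : fieldType).

Definition left_ker m n (Z : 'M[F]_(m, n)) : {vspace 'cV[F]_m} :=
  lker (linfun (mulmxr Z \o trmx : 'cV[F]_m -> 'rV[F]_n)).

Definition mx_img m n (S : 'M[F]_(m, n)) (V : {vspace 'cV[F]_n}) :
    {vspace 'cV[F]_m} :=
  (linfun (mulmx S : 'cV[F]_n -> 'cV[F]_m) @: V)%VS.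

Definition range_mx m n (S : 'M[F]_(m, n)) : {vspace 'cV[F]_m} :=
  mx_img S fullv.

Definition krank m n (Z : 'M[F]_(m, n)) : nat :=
  \max_(k < n.+1 | [forall S : {set 'I_n},
                      (#|S| == k) ==> free [seq col j Z | j <- enum S]]) k.

Lemma mem_left_ker m n (Z : 'M[F]_(m, n)) (v : 'cV[F]_m) :
  (v \in left_ker Z) = (v^T *m Z == 0).
Proof. by rewrite memv_ker lfunE. Qed.

Lemma memv_mx_imgP m n (S : 'M[F]_(m, n)) (V : {vspace 'cV[F]_n})
    (w : 'cV[F]_m) :
  reflect (exists2 v, v \in V & w = S *m v) (w \in mx_img S V).
Proof.
by apply: (iffP memv_imgP) => [] [v vV ->]; exists v; rewrite ?lfunE.
Qed.

End Spaces.

Section Symmetrization.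
Variables (F : fieldType).

Definition unit_cols n d (f : {ffun 'I_d -> 'I_n}) (t : 'I_d) : 'cV[F]_n :=
  delta_mx (f t) ord0.

(* The matrix of sigma_d.  The vectors kron (unit_cols f) form the standard
   basis of F^(n^d), and the summand of index f is the image of that basis
   vector times its transpose; see sigma_kron. *)
Definition sigma n d : 'M[F]_(n ^ d) :=
  \sum_(f : {ffun 'I_d -> 'I_n})
    ((d`!)%:R^-1 *: \sum_(tau : 'S_d) kron (fun t => unit_cols f (tau t)))
    *m (kron (unit_cols f))^T.

(* sigma_2 o (sigma_2 x sigma_2), the outer sigma_2 being taken for n ^ 2. *)
Definition sigma22 n : 'M[F]_(n ^ 2 * n ^ 2) :=
  sigma (n ^ 2) 2 *m (sigma n 2 *t sigma n 2).

Lemma kron_recE n d (i : 'I_(n ^ d.+1)) :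
  exists g : 'I_d.+1 -> 'I_n,
    forall x : 'I_d.+1 -> 'cV[F]_n,
      kron_rec x i ord0 = \prod_t x t (g t) ord0.
Proof.
elim: d i => [|d IHd] i.
  by exists (fun=> i) => x; rewrite big_ord_recl big_ord0 mulr1.
have [g Hg] := IHd (@mxtens_unindex n (n ^ d.+1) i).2.
exists (fun t => if unlift ord0 t is Some u then g u
                 else (@mxtens_unindex n (n ^ d.+1) i).1) => x.
rewrite big_ord_recl unlift_none /= mxE.
congr (x _ _ _ * _); first by apply: val_inj.
rewrite (_ : (mxtens_unindex _).2 = ord0); last by apply: val_inj.
by rewrite Hg; apply: eq_bigr => t _; rewrite liftK.
Qed.

Lemma kron_multilinear n d (x : 'I_d -> 'cV[F]_n) :
  kron x = \sum_(f : {ffun 'I_d -> 'I_n})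
             (\prod_t x t (f t) ord0) *: kron (unit_cols f).
Proof.
have [g Hg] : exists g : 'I_(n ^ d) -> 'I_d -> 'I_n,
    forall i (y : 'I_d -> 'cV[F]_n), kron y i ord0 = \prod_t y t (g i t) ord0.
  case: d x => [|d] _.
    by exists (fun _ (t : 'I_0) => False_rect _ (notF (ltn_ord t)))
      => i y; rewrite big_ord0 mxE.
  have [g Hg] := fin_all_exists (@kron_recE n d).
  by exists g => i y; rewrite -Hg.
apply/colP => i; rewrite summxE Hg.
under [RHS]eq_bigr => f _.
  rewrite mxE Hg -big_split /=; over.
rewrite -(bigA_distr_bigA (fun t j => x t j ord0 * delta_mx j ord0 (g i t) ord0)).
apply: eq_bigr => t _; rewrite (bigD1 (g i t)) //= big1 => [|j jg].
  by rewrite addr0 mxE !eqxx mulr1.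
by rewrite mxE eq_sym (negbTE jg) mulr0.
Qed.

Lemma kron_dot n d (x y : 'I_d -> 'cV[F]_n) :
  (kron x)^T *m kron y = (\prod_t ((x t)^T *m y t) ord0 ord0)%:M.
Proof.
case: d x y => [|d] x y.
  by rewrite big_ord0 [LHS]mx11_scalar mxE big_ord1 !mxE mulr1.
elim: d x y => [|d IHd] x y.
  by rewrite big_ord1 -mx11_scalar.
set x' := fun t => x (lift ord0 t); set y' := fun t => y (lift ord0 t).
have kE : (kron x)^T *m kron y
    = ((x ord0)^T *m y ord0) *t ((kron x')^T *m kron y') :> 'M_1.
  rewrite -(tensmx_mul (x ord0)^T (kron x')^T (y ord0) (kron y')).
  by congr (_ *m _); exact: (trmx_tens (x ord0) (kron x')).
rewrite kE IHd [in RHS]big_ord_recl [LHS]mx11_scalar mxE; congr (_%:M).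
congr ((_ : 'M_1) _ _ * _); [exact: val_inj|exact: val_inj|].
by rewrite mxE (_ : _ == _) ?mulr1n //; apply/eqP/val_inj.
Qed.

Lemma sigma_kron n d (x : 'I_d -> 'cV[F]_n) :
  sigma n d *m kron x =
    (d`!)%:R^-1 *: \sum_(tau : 'S_d) kron (fun t => x (tau t)).
Proof.
rewrite /sigma mulmx_suml.
under eq_bigr => f _.
  rewrite -mulmxA kron_dot mul_mx_scalar scalerA mulrC -scalerA scaler_sumr.
  rewrite (eq_bigr (fun t => x t (f t) ord0)); last first.
    move=> t _; rewrite /unit_cols trmx_delta mxE (bigD1 (f t)) //= big1.
      by rewrite mxE !eqxx mul1r addr0.
    by move=> j jf; rewrite mxE eqxx (negbTE jf) mul0r.
  over.
rewrite -scaler_sumr exchange_big /=; congr (_ *: _).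
apply: eq_bigr => tau _; rewrite kron_multilinear.
pose h (s : 'S_d) (f : {ffun 'I_d -> 'I_n}) := [ffun t => f (s t)].
rewrite [RHS](reindex (h tau)) /=; last first.
  exists (h tau^-1%g) => f _; apply/ffunP => t; rewrite !ffunE.
    by rewrite permKV.
  by rewrite permK.
apply: eq_bigr => f _; congr (_ *: kron _).
  rewrite (reindex_inj (@perm_inj _ tau)) /=.
  by apply: eq_bigr => t _; rewrite ffunE.
by apply/boolp.funext => t; rewrite /unit_cols ffunE.
Qed.

Lemma sigma22_kron n (z y b a : 'cV[F]_n) :
  sigma22 n *m ((z *t y) *t (b *t a)) =
    sigma (n ^ 2) 2 *m ((sigma n 2 *m (z *t y)) *t (sigma n 2 *m (b *t a))).
Proof. by rewrite /sigma22 -mulmxA tensmx_mul. Qed.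

End Symmetrization.

Arguments sigma F n d : clear implicits.
Arguments sigma22 F n : clear implicits.

Section ParaTuck2.
Variables (F : fieldType).

Definition dedicom m r K (A : 'M[F]_(m, r)) (S : 'M[F]_r) (G : 'M[F]_(r, K))
    (k : 'I_K) : 'M[F]_m :=
  A *m diag_mx (col k G)^T *m S *m diag_mx (col k G)^T *m A^T.

Definition Phi n K (T : 'I_K -> 'M[F]_n) : 'M[F]_(n ^ 2 * n ^ 2, K) :=
  \matrix_(i, k) (vec (T k) *t vec (T k) : 'cV_(n ^ 2 * n ^ 2)) i ord0.

End ParaTuck2.

Lemma expn22 n : (n ^ 2 * n ^ 2 = n ^ 4)%N.
Proof. by rewrite -expnD. Qed.

(* Main.v *)
From HB Require Import structures.
Require Import Defs.
From mathcomp Require Import all_boot all_order all_fingroup all_algebra.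
From mathcomp Require Import mxtens reals ring zify.
From mathcomp Require boolp.

Set Implicit Arguments.
Unset Strict Implicit.
Unset Printing Implicit Defensive.

Import GRing.Theory Num.Theory.
Local Open Scope ring_scope.

(** Write a_i for the columns of A and b_i for the dual basis. The vectorized
    slice is a weighted product: vec T_k = L (g_k (x) g_k), where L = loading
    sends e_i (x) e_j to F_ij a_i (x) a_j. Hence Phi(T) is an invertible matrix,
    L (x) L, times the fourth Khatri-Rao power of G, whose columns span all
    symmetric tensors by the rank assumption. So v is in lker Phi(T) exactly
    when the full symmetrization of (L (x) L)^T v vanishes. Since sigma_(2,2) is
    a symmetric projection fixing the columns of Phi(T), its rank minus that of
    Phi(T) is the dimension of V = sigma_(2,2)(lker Phi(T)); the ranks involved
    are computed in rank_sigma22 and, as traces of projections, in rank_sigma.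

    The elements v of V are thus the tensors invariant under sigma_(2,2) whose
    coordinates satisfy, for every i, j, k, l, one linear relation between the
    three ways to pair up the four indices, with weights F_ij F_kl, F_ik F_jl
    and F_il F_jk (kernel_space_pairings). The coordinate of sigma_4 v is the
    mean of the same three coordinates, without weights. Two consequences carry
    the proof. When the three weights agree, this mean vanishes for all v in V
    (kernel_space_balanced). When the first two differ, the difference of
    b_i (x) b_j (x) b_k (x) b_l and b_i (x) b_k (x) b_j (x) b_l, each divided by
    its weight, is in lker Phi(T) and shows that the symmetrization of b_i, b_j,
    b_k, b_l lies in sigma_4(V) (exchange_kernel_space).

    The columns of Psym are the contractions of sigma_4(V) by one factor. They
    are symmetric, so rank Psym = binomial(R + 2, 3) - dim W for
    W = sigma_3(lker Psym), the space of symmetric tensors of order three that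
    annihilate these contractions. For the indices l, k, k, k the weights agree,
    so W contains the R independent cubes a_k (x) a_k (x) a_k, which gives the
    bound; equality holds if and only if W is spanned by the cubes. If columns
    j and k of F are proportional, the weights for l, j, j, k agree for every l,
    and W also contains the symmetrization of a_j, a_j, a_k. If no two columns
    are proportional, then for j <> k and every i some l has
    F_ij F_kl <> F_ik F_jl; contracting the symmetrization of b_i, b_j, b_k, b_l
    with a_l shows that W is orthogonal to b_i (x) b_j (x) b_k, and only
    combinations of cubes are orthogonal to all of these. *)

(** * Pairing of vectors, kernels, ranges and ranks *)

Section LinearAlgebra.
Variable F : fieldType.

Definition dot n (x y : 'cV[F]_n) : F := (x^T *m y) ord0 ord0.

Lemma dotC n (x y : 'cV[F]_n) : dot x y = dot y x.
Proof. by rewrite /dot -[y^T *m x]trmxK trmx_mul trmxK [RHS]mxE. Qed.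

Lemma dot_linear n (x : 'cV[F]_n) : linear_for *%R (dot x).
Proof. by move=> c y z; rewrite /dot mulmxDr -scalemxAr !mxE. Qed.

HB.instance Definition _ n (x : 'cV[F]_n) :=
  GRing.isLinear.Build F 'cV[F]_n F *%R (dot x) (@dot_linear n x).

Lemma dotDl n (x y z : 'cV[F]_n) : dot (x + y) z = dot x z + dot y z.
Proof. by rewrite dotC linearD /= !(dotC z). Qed.

Lemma dotZl n c (x z : 'cV[F]_n) : dot (c *: x) z = c * dot x z.
Proof. by rewrite dotC linearZ /= dotC. Qed.

Lemma dot_suml n (I : Type) (r : seq I) (P : pred I) (x : I -> 'cV[F]_n) z :
  dot (\sum_(i <- r | P i) x i) z = \sum_(i <- r | P i) dot (x i) z.
Proof. by rewrite dotC linear_sum; apply: eq_bigr => i _; rewrite dotC. Qed.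

Lemma dot_mul m n (M : 'M[F]_(m, n)) x y : dot x (M *m y) = dot (M^T *m x) y.
Proof. by rewrite /dot trmx_mul trmxK mulmxA. Qed.

Lemma dot_tens m n (x x' : 'cV[F]_m) (y y' : 'cV[F]_n) :
  dot (x *t y : 'cV_(m * n)) (x' *t y' : 'cV_(m * n)) = dot x x' * dot y y'.
Proof.
rewrite /dot -[_^T *m _]/((x *t y)^T *m (x' *t y')) trmx_tens tensmx_mul mxE.
by rewrite !ord1; congr ((_ : 'M_1) _ _ * (_ : 'M_1) _ _); apply: val_inj.
Qed.

Lemma dot_delta n i (v : 'cV[F]_n) : dot (delta_mx i ord0) v = v i ord0.
Proof. by rewrite /dot trmx_delta -rowE mxE. Qed.

Lemma dot_col m n (M : 'M[F]_(m, n)) k v : dot (col k M) v = (v^T *m M) ord0 k.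
Proof. by rewrite dotC /dot colE mulmxA -colE mxE. Qed.

Lemma dot_ext n (v w : 'cV[F]_n) : (forall x, dot x v = dot x w) -> v = w.
Proof.
by move=> vw; apply/colP => i; have := vw (delta_mx i ord0); rewrite !dot_delta.
Qed.

Lemma tensmx_linear m n p q (x : 'M[F]_(m, n)) : linear (@tensmx F m n p q x).
Proof. by move=> c y z; apply/matrixP => i j; rewrite !mxE mulrDr mulrCA. Qed.

HB.instance Definition _ m n p q (x : 'M[F]_(m, n)) :=
  GRing.isLinear.Build F 'M[F]_(p, q) 'M[F]_(m * p, n * q) _ (tensmx x)
    (@tensmx_linear m n p q x).

Lemma tensDl m n p q (x x' : 'M[F]_(m, n)) (y : 'M[F]_(p, q)) :
  (x + x') *t y = x *t y + x' *t y.
Proof. by apply/matrixP => i j; rewrite !mxE mulrDl. Qed.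

Lemma tensZl m n p q c (x : 'M[F]_(m, n)) (y : 'M[F]_(p, q)) :
  (c *: x) *t y = c *: (x *t y).
Proof. by apply/matrixP => i j; rewrite !mxE mulrA. Qed.

Lemma tens_suml m n p q (I : Type) (r : seq I) (P : pred I)
    (x : I -> 'M[F]_(m, n)) (y : 'M[F]_(p, q)) :
  (\sum_(i <- r | P i) x i) *t y = \sum_(i <- r | P i) x i *t y.
Proof.
elim/big_rec2: _ => [|i _ x' _ <-]; first by rewrite tens0mx.
by rewrite tensDl.
Qed.

Lemma delta_tens m n (i : 'I_m) (j : 'I_n) :
  delta_mx (mxtens_index (i, j)) ord0 =
    ((delta_mx i ord0 : 'cV_m) *t (delta_mx j ord0 : 'cV_n) : 'cV[F]_(m * n)).
Proof.
apply/colP => k; case: (mxtens_indexP k) => k0 k'.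
rewrite [RHS]mxE mxtens_indexK !mxE /= !andbT -natrM mulnb.
by rewrite (can_eq (@mxtens_indexK _ _)).
Qed.

Lemma left_kerP m n (Z : 'M[F]_(m, n)) v :
  reflect (forall x, dot v (Z *m x) = 0) (v \in left_ker Z).
Proof.
rewrite mem_left_ker; apply: (iffP eqP) => [vZ x|vZ].
  by rewrite /dot mulmxA vZ mul0mx mxE.
apply/rowP => k; have := vZ (delta_mx k ord0).
by rewrite -colE dotC dot_col => ->; rewrite mxE.
Qed.

Lemma mx_img_mul m n p (M : 'M[F]_(m, n)) (N : 'M_(n, p)) V :
  mx_img (M *m N) V = mx_img M (mx_img N V).
Proof.
apply/vspaceP => w; apply/memv_mx_imgP/memv_mx_imgP => [[v vV ->]|[x]].
  by exists (N *m v); rewrite ?mulmxA //; apply/memv_mx_imgP; exists v.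
by case/memv_mx_imgP => v vV -> ->; exists v; rewrite ?mulmxA.
Qed.

(** In a full rank factorization the right factor is onto and the left factor
    is injective. *)
Lemma dim_range m n (M : 'M[F]_(m, n)) : \dim (range_mx M) = \rank M.
Proof.
have [D rowK] := row_freeP (row_base_free M).
have [E colK] := row_fullP (col_base_full M).
rewrite /range_mx -{1}(mulmx_base M) mx_img_mul.
have -> : mx_img (row_base M) fullv = fullv.
  apply/vspaceP => v; rewrite memvf; apply/memv_mx_imgP.
  by exists (D *m v); rewrite ?memvf // mulmxA rowK mul1mx.
rewrite limg_dim_eq ?dimvf /dim /= ?muln1 //.
apply/eqP; rewrite -subv0; apply/subvP => v.
rewrite memv_cap memv_ker lfunE /= memv0 => /andP[_ /eqP colv].
by rewrite -[v]mul1mx -colK -mulmxA colv mulmx0.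
Qed.

Lemma left_kerE m n (Z : 'M[F]_(m, n)) :
  left_ker Z = lker (linfun (mulmx Z^T : 'cV_m -> 'cV_n)).
Proof.
apply/vspaceP => v; rewrite mem_left_ker memv_ker lfunE /= -[X in _ = (X == 0)]trmxK.
by rewrite trmx_mul trmxK trmx_eq0.
Qed.

Lemma dim_left_ker m n (Z : 'M[F]_(m, n)) :
  (\dim (left_ker Z) + \rank Z = m)%N.
Proof.
rewrite left_kerE -[\rank Z]mxrank_tr -dim_range.
rewrite -[X in _ = X](_ : \dim {:'cV[F]_m} = m); last by rewrite dimvf /dim /= muln1.
by rewrite -[RHS](limg_ker_dim (linfun (mulmx Z^T : 'cV_m -> 'cV_n))) capfv.
Qed.

(** A projection that fixes the columns of Z annihilates only vectors of the
    left kernel of Z, so it lowers the dimension of that kernel by its own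
    corank. *)
Lemma dim_img_left_ker m n (S : 'M[F]_m) (Z : 'M[F]_(m, n)) :
  S^T = S -> S *m Z = Z ->
  (\dim (mx_img S (left_ker Z)) + \rank Z = \rank S)%N.
Proof.
move=> trS SZ; pose f := linfun (mulmx S : 'cV_m -> 'cV_m).
have kerS : (left_ker S <= left_ker Z)%VS.
  apply/subvP => v; rewrite !mem_left_ker => /eqP vS.
  by rewrite -SZ mulmxA vS mul0mx.
have kerE : lker f = left_ker S by rewrite left_kerE trS.
apply/eqP; rewrite -(eqn_add2l (\dim (left_ker S))) addnA; apply/eqP.
rewrite (dim_left_ker S) -[RHS](dim_left_ker Z) -(limg_ker_dim f (left_ker Z)).
by rewrite kerE (capv_idPr kerS).
Qed.

Lemma mulmx_cols m n (M : 'M[F]_(m, n)) (v : 'cV_n) :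
  M *m v = \sum_k v k ord0 *: col k M.
Proof.
apply/colP => i; rewrite mxE summxE; apply: eq_bigr => k _.
by rewrite !mxE mulrC.
Qed.

Lemma span_cols m n (M : 'M[F]_(m, n)) :
  <<[seq col k M | k <- enum 'I_n]>>%VS = range_mx M.
Proof.
apply/eqP; rewrite eqEsubv; apply/andP; split.
  apply/span_subvP => _ /mapP[k _ ->]; apply/memv_mx_imgP.
  by exists (delta_mx k ord0); rewrite ?memvf // colE.
apply/subvP => _ /memv_mx_imgP[v _ ->].
rewrite mulmx_cols; apply: memv_suml => k _; apply/memvZ/memv_span.
by apply: map_f; rewrite mem_enum.
Qed.

Lemma left_ker_mxrowP m N n (P : 'I_N -> 'M[F]_(m, n)) u :
  reflect (forall i x, dot u (P i *m x) = 0) (u \in left_ker (\mxrow_(i < N) P i)).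
Proof.
rewrite mem_left_ker mul_mxrow; apply: (iffP eqP) => [uP i x|uP].
  have := congr1 (fun M => submxrow M i) uP; rewrite mxrowK submxrow0.
  by rewrite /dot mulmxA => ->; rewrite mul0mx mxE.
rewrite -mxrow0; apply: eq_mxrow => i; apply/eqP; rewrite -mem_left_ker.
exact/left_kerP.
Qed.

Lemma eq_cols m n (M N : 'M[F]_(m, n)) : (forall k, col k M = col k N) -> M = N.
Proof.
by move=> MN; apply/matrixP => i k; have /colP/(_ i) := MN k; rewrite !mxE.
Qed.

Lemma col_odot m n r (M : 'M[F]_(m, r)) (N : 'M[F]_(n, r)) k :
  col k (M \odot N) = (col k M *t col k N : 'cV_(m * n)).
Proof. by apply/colP => i; rewrite [LHS]mxE [LHS]mxE. Qed.

Lemma rank_unit_mul m n (U : 'M[F]_m) (Z : 'M[F]_(m, n)) :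
  U \in unitmx -> \rank (U *m Z) = \rank Z.
Proof.
move=> Uu; rewrite -mxrank_tr trmx_mul mxrankMfree ?mxrank_tr //.
by rewrite row_free_unit unitmx_tr.
Qed.

(** Equal ranks turn an inclusion of column spaces into an equality. *)
Lemma same_range_factor m n p (S : 'M[F]_(m, n)) (Z : 'M[F]_(m, p)) X :
  Z = S *m X -> \rank Z = \rank S -> exists Y, S = Z *m Y.
Proof.
move=> ZS rkZ; have sub : (Z^T <= S^T)%MS by rewrite ZS trmx_mul submxMl.
have : (S^T <= Z^T)%MS by rewrite -(geq_leqif (mxrank_leqif_sup sub)) !mxrank_tr rkZ.
by case/submxP => D SD; exists D^T; rewrite -[S]trmxK SD trmx_mul trmxK.
Qed.

(** For a full rank factorization P = C B, idempotence means B C = 1, and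
    C B has the trace of B C. *)
Lemma idem_rank_trace n (P : 'M[F]_n) : P *m P = P -> \tr P = (\rank P)%:R.
Proof.
move=> PP; have [D BD] := row_freeP (row_base_free P).
have [E EC] := row_fullP (col_base_full P).
have {BD EC} [C [B [CB [BD EC]]]] :
    exists C : 'M_(n, \rank P), exists B : 'M_(\rank P, n),
      C *m B = P /\ B *m D = 1%:M /\ E *m C = 1%:M.
  by exists (col_base P), (row_base P); rewrite mulmx_base.
have BC : B *m C = 1%:M.
  have : E *m (C *m B *m (C *m B)) *m D = E *m (C *m B) *m D by rewrite CB PP.
  by rewrite !mulmxA EC !mul1mx -!mulmxA BD mulmx1.
by rewrite -{1}CB mxtrace_mulC BC mxtrace1.
Qed.

(** The maximum in the Kruskal rank may be reached at a size larger than two: a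
    pair of columns is then completed to a set of that size, and inherits its
    independence. *)
Lemma krank2P m n (Z : 'M[F]_(m, n)) :
  (1 < n)%N -> (forall k, col k Z != 0) ->
  (2 <= krank Z)%N <->
  (forall j k, j != k -> forall c, col j Z != c *: col k Z).
Proof.
move=> n_gt1 col_neq0; split.
  pose Q (k : 'I_n.+1) := [forall S : {set 'I_n},
    (#|S| == k) ==> free [seq col j Z | j <- enum S]].
  rewrite -[krank Z]/(\max_(k < n.+1 | Q k) k) => krank_ge2 j k jk c.
  have [/forallP/= mfree m_ge2] :
      Q [arg max_(i > ord0 | Q i) i] /\ (2 <= [arg max_(i > ord0 | Q i) i])%N.
    have Q0 : Q ord0.
      apply/forallP => S; apply/implyP; rewrite cards_eq0 => /eqP->.
      by rewrite enum_set0 nil_free.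
    by rewrite -bigmax_eq_arg //; case: arg_maxnP.
  set m0 := [arg max_(i > ord0 | Q i) i] in mfree m_ge2 *.
  have : (0 < #|[set B : {set 'I_n} | B \subset ~: [set j; k] &
                 #|B| == (m0 - 2)%N]|)%N.
    rewrite cards_draws bin_gt0 cardsCs setCK cards2 jk card_ord.
    by rewrite leq_sub2r // -ltnS.
  case/card_gt0P => B; rewrite inE => /andP[Bjk /eqP cardB].
  have disj : [set j; k] :&: B = set0.
    by apply/eqP; rewrite setI_eq0 disjoint_sym disjoints_subset.
  have cardS : #|[set j; k] :|: B| = m0.
    by rewrite cardsU disj cards0 subn0 cards2 jk cardB subnKC.
  have := mfree ([set j; k] :|: B); rewrite cardS eqxx /=.
  have pE : perm_eq (enum ([set j; k] :|: B)) ([:: j; k] ++ enum B).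
    apply: uniq_perm; first exact: enum_uniq.
      rewrite cat_uniq enum_uniq andbT /= inE jk /=.
      rewrite -all_predC; apply/allP => x; rewrite mem_enum /= => xB.
      have := subsetP Bjk x xB; rewrite !inE; by [].
    by move=> x; rewrite mem_cat !mem_enum !inE.
  rewrite (perm_free (perm_map (fun j => col j Z) pE)) map_cat => /catl_free.
  rewrite free_cons span_seq1 => /andP[+ _].
  by apply: contra => /eqP->; rewrite memvZ ?memv_line.
move=> indep; rewrite /krank.
have n2 : (2 < n.+1)%N by [].
apply: (@leq_trans (Ordinal n2)) => //.
apply: (bigmax_sup (Ordinal n2)) => //; apply/forallP => S; apply/implyP.
case/cards2P => j [k [jk ->]].
have pE : perm_eq (enum [set j; k]) [:: j; k].
  apply: uniq_perm; rewrite ?enum_uniq //= ?inE ?jk //.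
  by move=> x; rewrite mem_enum !inE.
rewrite (perm_free (perm_map (fun j => col j Z) pE)) free_cons span_seq1.
rewrite seq1_free col_neq0 andbT; apply/negP => /vlineP[c cE].
by have := indep j k jk c; rewrite cE eqxx.
Qed.

End LinearAlgebra.

(** * The symmetrizing projections *)

Section Symmetrizer.
Variable F : numFieldType.

Lemma sum_perm_coset (V : nmodType) d (h : 'S_d.+1 -> V) :
  \sum_(tau : 'S_d.+1) h tau =
  \sum_(j < d.+1) \sum_(s : 'S_d) h (lift_perm ord0 ord0 s * tperm ord0 j)%g.
Proof.
pose phi (p : 'I_d.+1 * 'S_d) := (lift_perm ord0 ord0 p.2 * tperm ord0 p.1)%g.
have phi0 p : phi p ord0 = p.1 by rewrite permM lift_perm_id tpermL.
have phi_inj : injective phi.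
  move=> [j s] [j' s'] /[dup] eqphi /(congr1 (fun tau : 'S_d.+1 => tau ord0)).
  rewrite !phi0 /= => eqj; case: j' / eqj in eqphi *.
  have {eqphi} /mulIg/permP eqs := eqphi; congr (_, _); apply/permP => t.
  by have := eqs (lift ord0 t); rewrite !lift_perm_lift => /lift_inj.
rewrite pair_big (reindex phi) //; apply: onW_bij.
apply: (inj_card_bij phi_inj).
by rewrite card_prod card_ord !card_Sn factS.
Qed.

Lemma sum_ffun_split (V : nmodType) n d (h : {ffun 'I_d.+1 -> 'I_n} -> V) :
  \sum_f h f =
  \sum_(g : {ffun 'I_d -> 'I_n}) \sum_(i < n)
    h [ffun t => if unlift ord0 t is Some u then g u else i].
Proof.
pose phi (p : {ffun 'I_d -> 'I_n} * 'I_n) : {ffun 'I_d.+1 -> 'I_n} :=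
  [ffun t => if unlift ord0 t is Some u then p.1 u else p.2].
have phi_inj : injective phi.
  move=> [g i] [g' i'] /ffunP eqphi; congr (_, _).
    by apply/ffunP => u; have := eqphi (lift ord0 u); rewrite !ffunE liftK.
  by have := eqphi ord0; rewrite !ffunE unlift_none.
rewrite pair_big (reindex phi) //; apply: onW_bij.
apply: (inj_card_bij phi_inj).
by rewrite card_prod !card_ffun !card_ord expnS mulnC.
Qed.

Lemma delta_kron n d (i : 'I_(n ^ d.+1)) :
  exists f : 'I_d.+1 -> 'I_n,
    delta_mx i ord0 = kron (fun t => delta_mx (f t) ord0) :> 'cV[F]_(n ^ d.+1).
Proof.
elim: d i => [|d IHd] i; first by exists (fun=> i).
case: (@mxtens_indexP n (n ^ d.+1) i) => i0 i'.
have [f fE] := IHd i'.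
exists (fun t => if unlift ord0 t is Some u then f u else i0) => /=.
rewrite unlift_none; under [X in _ *t kron_rec X]boolp.eq_fun => t do rewrite liftK.
move: fE => /= <-; exact: delta_tens.
Qed.

Lemma kron_ext n d m (M N : 'M[F]_(m, n ^ d.+1)) :
  (forall x : 'I_d.+1 -> 'cV[F]_n, M *m kron x = N *m kron x) -> M = N.
Proof.
move=> MN; apply/matrixP => i j; have [f fE] := delta_kron j.
have := congr1 (fun v : 'cV_m => v i ord0) (MN (fun t => delta_mx (f t) ord0)).
by rewrite -fE -!colE !mxE.
Qed.

Lemma fact_neq0 d : (d`!)%:R != 0 :> F.
Proof. by rewrite pnatr_eq0 -lt0n fact_gt0. Qed.

Lemma sigma_kron_perm n d (x : 'I_d -> 'cV[F]_n) (s : 'S_d) :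
  sigma F n d *m kron (fun t => x (s t)) = sigma F n d *m kron x.
Proof.
rewrite !sigma_kron [in RHS](reindex_inj (mulIg s)) /=; congr (_ *: _).
apply: eq_bigr => tau _; congr kron; apply/boolp.funext => t.
by rewrite permM.
Qed.

Lemma sigma_kron_const n d (x : 'cV[F]_n) :
  sigma F n d *m kron (fun=> x) = kron (fun=> x).
Proof.
rewrite sigma_kron sumr_const card_Sn -scaler_nat scalerA mulVf ?scale1r //.
exact: fact_neq0.
Qed.

Lemma sigma_sum n d :
  sigma F n d = \sum_(f : {ffun 'I_d -> 'I_n})
    (sigma F n d *m kron (unit_cols F f)) *m (kron (unit_cols F f))^T.
Proof. by rewrite {1}/sigma; under [RHS]eq_bigr => f _ do rewrite sigma_kron. Qed.

Lemma sigma_idem n d : sigma F n d *m sigma F n d = sigma F n d.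
Proof.
rewrite {2}sigma_sum [RHS]sigma_sum mulmx_sumr; apply: eq_bigr => f _.
rewrite mulmxA; congr (_ *m _).
rewrite [in X in _ *m X]sigma_kron -scalemxAr mulmx_sumr.
under eq_bigr => tau _ do rewrite (sigma_kron_perm (unit_cols F f)).
rewrite sumr_const card_Sn -scaler_nat scalerA mulVf ?scale1r //.
exact: fact_neq0.
Qed.

Lemma trmx_sigma n d : (sigma F n d)^T = sigma F n d.
Proof.
have -> : sigma F n d = (d`!)%:R^-1 *: \sum_(tau : 'S_d) \sum_f
    kron (fun t => unit_cols F f (tau t)) *m (kron (unit_cols F f))^T.
  rewrite /sigma exchange_big scaler_sumr; apply: eq_bigr => f _.
  by rewrite -scalemxAl mulmx_suml.
rewrite linearZ /=; congr (_ *: _).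
rewrite linear_sum [in RHS](reindex_inj invg_inj) /=.
apply: eq_bigr => tau _; rewrite linear_sum.
pose h (s : 'S_d) (f : {ffun 'I_d -> 'I_n}) := [ffun t => f (s t)].
rewrite [RHS](reindex (h tau)) /=; last first.
  exists (h tau^-1%g) => f _; apply/ffunP => t; rewrite !ffunE.
    by rewrite permKV.
  by rewrite permK.
apply: eq_bigr => f _; rewrite trmx_mul trmxK.
congr (kron _ *m (kron _)^T); apply/boolp.funext => t; rewrite /unit_cols ffunE //.
by rewrite permKV.
Qed.

Lemma dot_sigma n d x y : dot x (sigma F n d *m y) = dot (sigma F n d *m x) y.
Proof. by rewrite dot_mul trmx_sigma. Qed.

Lemma sigma1 n : sigma F n 1 = 1%:M.
Proof.
apply: kron_ext => x; rewrite sigma_kron mul1mx factS fact0 invr1 scale1r.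
rewrite (eq_bigr (fun=> kron x)) => [|s _]; first by rewrite sumr_const card_Sn.
by congr kron; apply/boolp.funext => t; rewrite !ord1.
Qed.

(** Average first over the permutations that fix the first factor, then over
    the transpositions that represent their cosets. *)
Lemma sigma_peel n d (x : 'I_d.+2 -> 'cV[F]_n) :
  sigma F n d.+2 *m kron x =
  (d.+2)%:R^-1 *: \sum_(j < d.+2)
    (x j *t (sigma F n d.+1 *m kron (fun t : 'I_d.+1 =>
       if lift ord0 t == j then x ord0 else x (lift ord0 t))) : 'cV_(n ^ d.+2)).
Proof.
rewrite sigma_kron sum_perm_coset factS natrM invfM -scalerA scaler_sumr.
congr (_ *: _); apply: eq_bigr => j _.
rewrite sigma_kron linearZ /=; congr (_ *: _); rewrite linear_sum.
apply: eq_bigr => s _; rewrite permM lift_perm_id tpermL /=.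
apply: (congr1 (fun y => x j *t kron_rec y)).
apply/boolp.funext => t; rewrite permM lift_perm_lift.
by case: tpermP => [/eqP|->|/eqP/negPf ? /eqP/negPf->] //; rewrite ?eqxx.
Qed.

End Symmetrizer.

(** * Ranks of the symmetrizers *)

Section SymmetrizerRank.
Variable F : numFieldType.

Lemma trace_sigmaE n d : \tr (sigma F n d) =
  \sum_(f : {ffun 'I_d -> 'I_n})
    dot (kron (unit_cols F f)) (sigma F n d *m kron (unit_cols F f)).
Proof.
rewrite sigma_sum linear_sum; apply: eq_bigr => f _ /=.
by rewrite mxtrace_mulC -sigma_sum /dot trace_mx11.
Qed.

(** One step of the trace of the symmetrizer: with the last d + 1 basis vectors
    fixed, each of the d + 2 summands of sigma_peel is summed over the first
    one. The trivial transposition contributes n times the smaller trace; a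
    transposition with factor u is seen only when the first vector equals factor
    u, and then acts trivially. *)
Lemma sum_dot_sigma_split n d (g : {ffun 'I_d.+1 -> 'I_n}) :
  \sum_(i < n)
    (let f := [ffun t => if unlift ord0 t is Some u then g u else i] in
     dot (kron (unit_cols F f)) (sigma F n d.+2 *m kron (unit_cols F f))) =
  (d.+2)%:R^-1 * (n + d.+1)%:R *
    dot (kron (unit_cols F g)) (sigma F n d.+1 *m kron (unit_cols F g)).
Proof.
set D := dot (kron (unit_cols F g)) _.
pose e i : 'cV[F]_n := delta_mx i ord0.
have dot_e i j : dot (e i) (e j) = (i == j)%:R by rewrite dot_delta mxE eqxx andbT.
transitivity (\sum_(i < n) (d.+2)%:R^-1 * (D + \sum_(u < d.+1) (i == g u)%:R * D)).
  apply: eq_bigr => i _; lazy zeta; set f := [ffun t => _].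
  have f0 : unit_cols F f ord0 = e i by rewrite /unit_cols ffunE unlift_none.
  have fS t : unit_cols F f (lift ord0 t) = unit_cols F g t.
    by rewrite /unit_cols ffunE liftK.
  have fE : (fun t => unit_cols F f (lift ord0 t)) = unit_cols F g.
    exact/boolp.funext.
  have kE : kron (unit_cols F f) = (e i *t kron (unit_cols F g) : 'cV_(n ^ d.+2)).
    by rewrite -fE -f0.
  rewrite sigma_peel kE linearZ /= linear_sum /= big_ord_recl; congr (_ * (_ + _)).
    rewrite f0 dot_tens dot_e eqxx mul1r; congr (dot _ (_ *m _)).
    by apply: (congr1 (@kron_rec F n d)); apply/boolp.funext => t; rewrite /= fS.
  apply: eq_bigr => u _; rewrite dot_tens fS dot_e.
  have [iu|_] := eqVneq i (g u); last by rewrite !mul0r.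
  rewrite !mul1r; congr (dot _ (_ *m _)).
  apply: (congr1 (@kron_rec F n d)); apply/boolp.funext => t.
  rewrite (inj_eq lift_inj) fS.
  by case: eqP => // ->; rewrite /unit_cols -iu.
rewrite -mulr_sumr big_split /= sumr_const card_ord -mulrA; congr (_ * _).
rewrite natrD mulrDl -[D *+ n]mulr_natl; congr (_ + _).
rewrite exchange_big /=.
rewrite (eq_bigr (fun=> D)) => [|u _]; first by rewrite sumr_const card_ord mulr_natl.
rewrite (bigD1 (g u)) //= eqxx mul1r big1 ?addr0 // => i /negPf->.
by rewrite mul0r.
Qed.

(** The traces satisfy (d + 1) t(d + 1) = (n + d) t(d), the recurrence of the
    binomial coefficients. *)
Lemma trace_sigma n d : \tr (sigma F n d.+1) = 'C(n + d, d.+1)%:R.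
Proof.
elim: d => [|d IHd]; first by rewrite sigma1 mxtrace1 expn1 addn0 bin1.
rewrite trace_sigmaE sum_ffun_split.
under eq_bigr => g _ do rewrite sum_dot_sigma_split.
rewrite -mulr_sumr -trace_sigmaE IHd -mulrA -natrM addnS mul_bin_diag natrM mulKf //.
by rewrite pnatr_eq0.
Qed.

Lemma rank_sigma n d : \rank (sigma F n d.+1) = 'C(n + d, d.+1).
Proof.
apply/eqP; rewrite -(eqr_nat F) -trace_sigma.
by rewrite (idem_rank_trace (sigma_idem F n d.+1)).
Qed.

End SymmetrizerRank.

(** * Symmetrizers of order two, three and four *)

Section LowOrders.
Variable F : numFieldType.

Definition kron2 n (x y : 'cV[F]_n) : 'cV[F]_(n ^ 2) := x *t y.
Definition kron3 n (x y z : 'cV[F]_n) : 'cV[F]_(n ^ 3) := x *t kron2 y z.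
Definition kron4 n (x y z t : 'cV[F]_n) : 'cV[F]_(n ^ 4) := x *t kron3 y z t.
Definition kron22 n (x y z t : 'cV[F]_n) : 'cV[F]_(n ^ 2 * n ^ 2) :=
  kron2 x y *t kron2 z t.

Lemma sigma2E n (x y : 'cV[F]_n) :
  sigma F n 2 *m kron2 x y = 2%:R^-1 *: (kron2 x y + kron2 y x).
Proof.
rewrite -[kron2 x y]/(kron (tnth [tuple x; y])) sigma_peel sigma1.
by rewrite 2!big_ord_recl big_ord0 !mul1mx addr0.
Qed.

Lemma sigma3E n (x y z : 'cV[F]_n) :
  sigma F n 3 *m kron3 x y z = 3%:R^-1 *:
    (x *t (sigma F n 2 *m kron2 y z) + y *t (sigma F n 2 *m kron2 x z)
     + z *t (sigma F n 2 *m kron2 y x)).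
Proof.
rewrite -[kron3 x y z]/(kron (tnth [tuple x; y; z])) sigma_peel.
by rewrite 3!big_ord_recl big_ord0 addr0 !addrA.
Qed.

Lemma sigma4E n (x y z t : 'cV[F]_n) :
  sigma F n 4 *m kron4 x y z t = 4%:R^-1 *:
    (x *t (sigma F n 3 *m kron3 y z t) + y *t (sigma F n 3 *m kron3 x z t)
     + z *t (sigma F n 3 *m kron3 y x t) + t *t (sigma F n 3 *m kron3 y z x)).
Proof.
rewrite -[kron4 x y z t]/(kron (tnth [tuple x; y; z; t])) sigma_peel.
by rewrite 4!big_ord_recl big_ord0 addr0 !addrA.
Qed.

End LowOrders.

Section LowOrderIdentities.
Variable F : numFieldType.
Local Notation e i := (delta_mx i ord0 : 'cV[F]__).

Lemma tens11 m n : 1%:M *t 1%:M = 1%:M :> 'M[F]_(m * n).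
Proof.
apply/matrixP => i j; case: (mxtens_indexP i) (mxtens_indexP j) => a b [c d].
rewrite tensmxE !mxE -natrM mulnb -[_ && _]/((a, b) == (c, d)).
by rewrite (can_eq (@mxtens_indexK _ _)).
Qed.

Lemma tens_unit m n (X : 'M[F]_m) (Y : 'M[F]_n) :
  X \in unitmx -> Y \in unitmx -> X *t Y \in unitmx.
Proof.
move=> unitX unitY; suff : (invmx X *t invmx Y) *m (X *t Y) = 1%:M by case/mulmx1_unit.
by rewrite tensmx_mul !mulVmx // tens11.
Qed.

Lemma kron2_ext n m (M N : 'M[F]_(m, n ^ 2)) :
  (forall i j, M *m kron2 (e i) (e j) = N *m kron2 (e i) (e j)) -> M = N.
Proof.
move=> MN; apply/matrixP => i j; case: (@mxtens_indexP n n j) => a b.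
have := congr1 (fun v : 'cV_m => v i ord0) (MN a b).
by rewrite /kron2 -!delta_tens -!colE !mxE.
Qed.

Lemma kron22_ext n m (M N : 'M[F]_(m, n ^ 2 * n ^ 2)) :
  (forall i j k l, M *m kron22 (e i) (e j) (e k) (e l) =
                   N *m kron22 (e i) (e j) (e k) (e l)) -> M = N.
Proof.
move=> MN; apply/matrixP => i j.
case: (mxtens_indexP j) => j1 j2.
case: (@mxtens_indexP n n j1) => a b; case: (@mxtens_indexP n n j2) => c d.
have := congr1 (fun v : 'cV_m => v i ord0) (MN a b c d).
by rewrite /kron22 /kron2 -!delta_tens -!colE !mxE.
Qed.

Lemma sigma2_swap n (x y : 'cV[F]_n) :
  sigma F n 2 *m kron2 x y = sigma F n 2 *m kron2 y x.
Proof. by rewrite !sigma2E addrC. Qed.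

Lemma sigma3_swap12 n (x y z : 'cV[F]_n) :
  sigma F n 3 *m kron3 x y z = sigma F n 3 *m kron3 y x z.
Proof.
by rewrite !sigma3E (sigma2_swap y x) (addrC (x *t _)).
Qed.

Lemma sigma3_swap23 n (x y z : 'cV[F]_n) :
  sigma F n 3 *m kron3 x y z = sigma F n 3 *m kron3 x z y.
Proof.
rewrite !sigma3E (sigma2_swap z y) (sigma2_swap y x) (sigma2_swap z x).
by rewrite addrAC.
Qed.

Lemma sigma4_swap12 n (x y z t : 'cV[F]_n) :
  sigma F n 4 *m kron4 x y z t = sigma F n 4 *m kron4 y x z t.
Proof.
rewrite !sigma4E (addrC (x *t _)) (sigma3_swap12 x y t) (sigma3_swap12 x z y).
by rewrite (sigma3_swap23 z x y) (sigma3_swap12 z y x).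
Qed.

Lemma sigma4_swap23 n (x y z t : 'cV[F]_n) :
  sigma F n 4 *m kron4 x y z t = sigma F n 4 *m kron4 x z y t.
Proof.
rewrite !sigma4E (sigma3_swap12 y z t) (sigma3_swap12 y z x).
by rewrite (sigma3_swap12 z x t) (sigma3_swap12 y x t) (addrAC (x *t _)).
Qed.

Lemma sigma4_swap34 n (x y z t : 'cV[F]_n) :
  sigma F n 4 *m kron4 x y z t = sigma F n 4 *m kron4 x y t z.
Proof.
rewrite !sigma4E (sigma3_swap23 y z t) (sigma3_swap23 x z t).
by rewrite (sigma3_swap23 y x t) (sigma3_swap23 y z x) (addrAC (_ + _)).
Qed.

(** The permutations of the factors after the first are among those averaged
    over on the left. *)
Lemma sigma_absorb n d (x : 'cV[F]_n) (u : 'cV[F]_(n ^ d.+1)) :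
  sigma F n d.+2 *m (x *t (sigma F n d.+1 *m u)) = sigma F n d.+2 *m (x *t u).
Proof.
have -> : x *t (sigma F n d.+1 *m u) = (1%:M *t sigma F n d.+1) *m (x *t u).
  by rewrite tensmx_mul mul1mx.
rewrite mulmxA; congr (_ *m _).
have := @kron_ext F n d.+1 _
  (sigma F n d.+2 *m (1%:M *t sigma F n d.+1)) (sigma F n d.+2).
apply=> y; rewrite -mulmxA.
have -> : (1%:M *t sigma F n d.+1) *m kron y =
    (y ord0 *t (sigma F n d.+1 *m kron (fun t => y (lift ord0 t))) : 'cV_(n ^ d.+2)).
  by rewrite -[y ord0 in RHS]mul1mx -tensmx_mul.
rewrite sigma_kron linearZ /= linear_sum /= -scalemxAr mulmx_sumr.
rewrite (eq_bigr (fun=> sigma F n d.+2 *m kron y)) => [|s _].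
  rewrite sumr_const card_Sn -scaler_nat scalerA mulVf ?scale1r //.
  exact: fact_neq0.
rewrite -(sigma_kron_perm y (lift_perm ord0 ord0 s)).
congr (_ *m _); rewrite /kron /= lift_perm_id.
apply: (congr1 (fun w => y ord0 *t kron_rec w)).
by apply/boolp.funext => t; rewrite lift_perm_lift.
Qed.

Lemma mul_kron2 m n (X : 'M[F]_(m, n)) x y :
  (X *t X) *m kron2 x y = kron2 (X *m x) (X *m y).
Proof. exact: (tensmx_mul X X x y). Qed.

Lemma mul_kron3 m n (X : 'M[F]_(m, n)) x y z :
  (X *t (X *t X)) *m kron3 x y z = kron3 (X *m x) (X *m y) (X *m z).
Proof. by rewrite [LHS](tensmx_mul X (X *t X) x (kron2 y z)) mul_kron2. Qed.

Lemma sigma2_natural m n (X : 'M[F]_(m, n)) :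
  sigma F m 2 *m (X *t X) = (X *t X) *m sigma F n 2.
Proof.
have := @kron2_ext n _ (sigma F m 2 *m (X *t X)) ((X *t X) *m sigma F n 2).
apply=> i j; rewrite -!mulmxA sigma2E -scalemxAr mulmxDr.
by rewrite !mul_kron2 sigma2E.
Qed.

(** It suffices to commute with the inner symmetrizer: the outer one commutes
    with every square theta *t theta. *)
Lemma sigma22_natural n (theta : 'M[F]_(n ^ 2)) :
  sigma F n 2 *m theta = theta *m sigma F n 2 ->
  sigma22 F n *m (theta *t theta) = (theta *t theta) *m sigma22 F n.
Proof.
move=> comm; have comm2 := sigma2_natural theta.
have : (sigma F n 2 *t sigma F n 2) *m (theta *t theta) =
       (theta *t theta) *m (sigma F n 2 *t sigma F n 2).
  by rewrite !tensmx_mul comm.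
rewrite /sigma22; move: (sigma F n 2 *t _) (sigma F (n ^ 2) 2) comm2.
move=> S S2 comm2 commS.
by rewrite -mulmxA commS !mulmxA comm2.
Qed.

Lemma sigma22_idem n : sigma22 F n *m sigma22 F n = sigma22 F n.
Proof.
have SS : (sigma F n 2 *t sigma F n 2) *m (sigma F n 2 *t sigma F n 2)
    = sigma F n 2 *t sigma F n 2 by rewrite tensmx_mul sigma_idem.
have comm := sigma2_natural (sigma F n 2).
have idem := sigma_idem F (n ^ 2) 2.
rewrite /sigma22; move: (_ *t _) (sigma F (n ^ 2) 2) SS comm idem => S S2 SS comm idem.
by rewrite mulmxA -(mulmxA _ S) -comm mulmxA idem -mulmxA SS.
Qed.

Lemma trmx_sigma22 n : (sigma22 F n)^T = sigma22 F n.
Proof.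
have trS : (sigma F n 2 *t sigma F n 2)^T = sigma F n 2 *t sigma F n 2.
  by rewrite trmx_tens trmx_sigma.
have comm := sigma2_natural (sigma F n 2).
have trS2 := trmx_sigma F (n ^ 2) 2.
rewrite /sigma22; move: (_ *t _) (sigma F (n ^ 2) 2) trS comm trS2.
move=> S S2 trS comm trS2.
by rewrite trmx_mul trS trS2 comm.
Qed.

Lemma sigma22E n (x y z t : 'cV[F]_n) :
  sigma22 F n *m kron22 x y z t =
  sigma F (n ^ 2) 2 *m kron2 (sigma F n 2 *m kron2 x y) (sigma F n 2 *m kron2 z t).
Proof. exact: sigma22_kron. Qed.

Lemma sigma22_swap12 n (x y z t : 'cV[F]_n) :
  sigma22 F n *m kron22 x y z t = sigma22 F n *m kron22 y x z t.
Proof. by rewrite !sigma22E (sigma2_swap x y). Qed.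

Lemma sigma22_swap_pairs n (x y z t : 'cV[F]_n) :
  sigma22 F n *m kron22 x y z t = sigma22 F n *m kron22 z t x y.
Proof. by rewrite !sigma22E sigma2_swap. Qed.

Lemma sigma22_diag n (x : 'cV[F]_n) : sigma22 F n *m kron22 x x x x = kron22 x x x x.
Proof.
have diag m (y : 'cV[F]_m) : sigma F m 2 *m kron2 y y = kron2 y y.
  exact: (sigma_kron_const 2 y).
by rewrite sigma22E !diag.
Qed.

(** Factor the symmetrizer of order two as C B through a space of dimension
    r = binomial(n + 1, 2). By naturality sigma22 is then the symmetrizer of
    order two on that space, between the injection C *t C and the surjection
    B *t B. *)
Lemma rank_sigma22 n : \rank (sigma22 F n) = 'C('C(n.+1, 2).+1, 2).
Proof.
have rk2 : \rank (sigma F n 2) = 'C(n.+1, 2) by rewrite rank_sigma addn1.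
rewrite -rk2.
have [D BD] := row_freeP (row_base_free (sigma F n 2)).
have [E EC] := row_fullP (col_base_full (sigma F n 2)).
move: (col_base _) (row_base _) (mulmx_base (sigma F n 2)) EC BD.
move: (\rank _) E D => r E D C B CB EC BD.
have <- : \rank (sigma F r 2) = 'C(r.+1, 2) by rewrite rank_sigma addn1.
have -> : sigma22 F n = (C *t C) *m sigma F r 2 *m (B *t B).
  by rewrite -sigma2_natural -mulmxA tensmx_mul CB.
apply/eqP; rewrite eqn_leq; apply/andP; split.
  exact: leq_trans (mxrankM_maxl _ _) (mxrankM_maxr _ _).
set S := _ *m (B *t B).
have -> : sigma F r 2 = (E *t E) *m S *m (D *t D).
  rewrite /S -!mulmxA tensmx_mul BD tens11 mulmx1.
  by rewrite mulmxA tensmx_mul EC tens11 mul1mx.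
exact: leq_trans (mxrankM_maxl _ _) (mxrankM_maxr _ _).
Qed.

End LowOrderIdentities.

(** * Symmetrizing a tensor that is already symmetric within pairs *)

Section Regrouping.
Variable F : numFieldType.

Lemma dot_tens_ext m n (v w : 'cV[F]_(m * n)) :
  (forall (x : 'cV_m) (y : 'cV_n),
     dot (x *t y : 'cV_(m * n)) v = dot (x *t y : 'cV_(m * n)) w) -> v = w.
Proof.
move=> vw; apply/colP => k; case: (mxtens_indexP k) => i j.
by have := vw (delta_mx i ord0) (delta_mx j ord0); rewrite -delta_tens !dot_delta.
Qed.

(** Contracting the matricization P with x and u is pairing its vectorization
    with x *t u; all contractions of the P_n are read off in this way. *)
Lemma dot_vec m n (P : 'M[F]_(m, n)) (x : 'cV_n) (u : 'cV_m) :
  dot (x *t u : 'cV_(n * m)) (vec P) = dot u (P *m x).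
Proof.
have dotE p (y z : 'cV[F]_p) : dot y z = \sum_i y i ord0 * z i ord0.
  by rewrite /dot mxE; apply: eq_bigr => i _; rewrite mxE.
rewrite !dotE (reindex (@mxtens_index n m)) /=; last first.
  apply: onW_bij; exists (@mxtens_unindex n m); first exact: mxtens_indexK.
  exact: mxtens_unindexK.
rewrite (eq_bigr (fun p => x p.1 ord0 * u p.2 ord0 * P p.2 p.1)); last first.
  move=> [i j] _; rewrite !mxE mxtens_indexK /= !ord1.
  by congr (x _ _ * u _ _ * _); apply: val_inj.
rewrite -(pair_bigA _ (fun i j => x i ord0 * u j ord0 * P j i)) /= exchange_big.
apply: eq_bigr => j _; rewrite mxE mulr_sumr; apply: eq_bigr => i _.
by rewrite -mulrA mulrC -mulrA.
Qed.

Lemma vec_mul m n p q (A : 'M[F]_(m, n)) (X : 'M[F]_(n, p)) (B : 'M[F]_(q, p)) :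
  vec (A *m X *m B^T) = (B *t A) *m vec X.
Proof.
apply: dot_tens_ext => x u; rewrite [RHS]dot_mul trmx_tens.
rewrite [_ *m (x *t u)](tensmx_mul B^T A^T x u) !dot_vec.
by rewrite -!mulmxA dot_mul.
Qed.

(** The identity, between the dimensions n ^ 2 * n ^ 2 and n ^ 4; as a matrix
    it lets the cast be moved through products and transposed. *)
Definition regroup n : 'M[F]_(n ^ 4, n ^ 2 * n ^ 2) :=
  castmx (expn22 n, erefl) 1%:M.

Lemma regroupE n (v : 'cV[F]_(n ^ 2 * n ^ 2)) :
  castmx (expn22 n, erefl 1%N) v = regroup n *m v.
Proof.
rewrite /regroup; move: (n ^ 4)%N (expn22 n) => m eqm.
by case: m / eqm; rewrite !castmx_id mul1mx.
Qed.

Lemma trmx_regroupK n : (regroup n)^T *m regroup n = 1%:M.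
Proof.
rewrite /regroup; move: (n ^ 4)%N (expn22 n) => m eqm.
by case: m / eqm; rewrite !castmx_id trmx1 mul1mx.
Qed.

Lemma regroupK n : regroup n *m (regroup n)^T = 1%:M.
Proof.
rewrite /regroup; move: (n ^ 4)%N (expn22 n) => m eqm.
by case: m / eqm; rewrite !castmx_id trmx1 mul1mx.
Qed.

Lemma regroup_kron22 n (x y z t : 'cV[F]_n) : regroup n *m kron22 x y z t = kron4 x y z t.
Proof.
rewrite -regroupE; apply/colP => i; rewrite castmxE /=.
case: (@mxtens_indexP n (n ^ 3) i) => i1 j1.
case: (@mxtens_indexP n (n ^ 2) j1) => i2 j2.
case: (@mxtens_indexP n n j2) => i3 i4.
have -> : cast_ord (esym (expn22 n))
    (mxtens_index (i1, mxtens_index (i2, mxtens_index (i3, i4)))) =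
    @mxtens_index (n ^ 2) (n ^ 2) (@mxtens_index n n (i1, i2), mxtens_index (i3, i4)).
  by apply: val_inj => /=; rewrite !expnS ?expn0 ?muln1; nia.
rewrite /kron22 /kron4 /kron3 /kron2 !(mxE, mxtens_indexK) /= -!mulrA.
by congr (x _ _ * (y _ _ * (z _ _ * t _ _))); apply: val_inj.
Qed.

(** The regrouping of factors forgets the pairing that sigma22 respects. *)
Lemma sigma4_regroup_sigma22 n :
  sigma F n 4 *m regroup n *m sigma22 F n = sigma F n 4 *m regroup n.
Proof.
apply: kron22_ext => i j k l.
move: (delta_mx i _) (delta_mx j _) (delta_mx k _) (delta_mx l _) => x y z t.
rewrite -(mulmxA _ (sigma22 F n)) sigma22E sigma2E -!mulmxA regroup_kron22.
have kE (a b c d : 'cV[F]_n) : sigma F n 4 *m (regroup n *m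
    kron2 (sigma F n 2 *m kron2 a b) (sigma F n 2 *m kron2 c d)) =
    sigma F n 4 *m kron4 a b c d.
  have -> : kron2 (sigma F n 2 *m kron2 a b) (sigma F n 2 *m kron2 c d) =
      4%:R^-1 *: (kron22 a b c d + kron22 a b d c + (kron22 b a c d + kron22 b a d c)).
    rewrite !sigma2E -[LHS]/((2%:R^-1 *: (kron2 a b + kron2 b a)) *t
      (2%:R^-1 *: (kron2 c d + kron2 d c))) tensZl linearZ /= tensDl !linearD /=.
    by rewrite !scalerA -!invfM -!natrM.
  rewrite -!scalemxAr !mulmxDr !regroup_kron22.
  rewrite (sigma4_swap12 b a c d) (sigma4_swap12 b a d c) (sigma4_swap34 a b d c).
  rewrite -!mulr2n -mulrnA -[4%:R]/(2 * 2)%:R -scaler_nat scalerA mulVf ?scale1r //.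
  by rewrite pnatr_eq0.
rewrite -!scalemxAr !mulmxDr !kE.
rewrite (sigma4_swap23 z t x y) (sigma4_swap12 z x t y) (sigma4_swap34 x z t y).
rewrite (sigma4_swap23 x z y t).
rewrite -mulr2n -scaler_nat scalerA mulVf ?scale1r //.
by rewrite pnatr_eq0.
Qed.

(** Moving factors of the three ways to pair up x, y, z, t into the form of one
    of them takes only swaps within pairs and of the pairs, under which v is
    invariant; the 24 terms of the full symmetrization thus fall into three
    groups of eight. *)
Lemma dot_sigma4_pairings n (x y z t : 'cV[F]_n) v :
  sigma22 F n *m v = v ->
  dot (kron4 x y z t) (sigma F n 4 *m (regroup n *m v)) =
  3%:R^-1 * (dot (kron22 x y z t) v + dot (kron22 x z y t) v + dot (kron22 x t y z) v).
Proof.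
move=> vE; rewrite dot_sigma.
pose w a b c d := dot (kron22 a b c d) v.
have h1 (a b c d : 'cV_n) : w a b c d = w b a c d.
  by rewrite /w -vE !dot_mul trmx_sigma22 sigma22_swap12.
have h2 (a b c d : 'cV_n) : w a b c d = w c d a b.
  by rewrite /w -vE !dot_mul trmx_sigma22 sigma22_swap_pairs.
have h3 (a b c d : 'cV_n) : w a b c d = w a b d c by rewrite h2 h1 h2.
have wE (a b c d : 'cV_n) : dot (a *t kron3 b c d : 'cV_(n ^ 4)) (regroup n *m v) =
    w a b c d.
  rewrite -[a *t _]/(kron4 a b c d) -regroup_kron22 dot_mul mulmxA trmx_regroupK.
  by rewrite mul1mx.
have w2 (a b c d : 'cV_n) : dot (a *t (b *t (sigma F n 2 *m kron2 c d)) : 'cV_(n ^ 4))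
    (regroup n *m v) = w a b c d.
  rewrite sigma2E !linearZ /= dotZl !linearD /= dotDl.
  rewrite -[b *t kron2 c d]/(kron3 b c d) -[b *t kron2 d c]/(kron3 b d c) !wE (h3 a b d).
  by field.
have w3 (a b c d : 'cV_n) : dot (a *t (sigma F n 3 *m kron3 b c d) : 'cV_(n ^ 4))
    (regroup n *m v) = 3%:R^-1 * (w a b c d + w a c b d + w a d b c).
  rewrite sigma3E linearZ /= dotZl !linearD /= !dotDl !w2.
  by rewrite (h3 a d c b).
rewrite sigma4E dotZl !dotDl !w3 -!/(w _ _ _ _).
rewrite (h2 z t y x) (h1 y x z t) (h2 y z x t) (h2 y t x z) (h2 z y x t).
rewrite (h3 x t z y) (h1 z x y t) (h2 t y z x) (h1 z x t y) (h3 x z t y).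
rewrite (h2 t z y x) (h1 y x t z) (h3 x y t z) (h1 t x y z).
by field.
Qed.

End Regrouping.

(** * The weighted products that make up the slices *)

Section Loading.
Variables (F : numFieldType) (n : nat) (A S : 'M[F]_n).
Hypothesis weightT : S^T = S.
Local Notation e i := (delta_mx i ord0 : 'cV[F]_n).
Local Notation a i := (col i A).

(** The slices are linear in g g^T: this matrix sends vec(g g^T) to
    vec(A Diag(g) S Diag(g) A^T), where S is the symmetric factor, whose entries
    act as weights. *)
Definition loading : 'M[F]_(n ^ 2) := (A *t A) *m diag_mx (vec S)^T.

Definition loading2 : 'M[F]_(n ^ 2 * n ^ 2) := loading *t loading.

Lemma weight_sym i j : S i j = S j i.
Proof. by rewrite -{1}weightT mxE. Qed.

Lemma vec_dedicom K (G : 'M[F]_(n, K)) k :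
  vec (dedicom A S G k) = loading *m kron2 (col k G) (col k G).
Proof.
set D := diag_mx (col k G)^T.
have -> : dedicom A S G k = A *m (D *m S *m D) *m A^T by rewrite !mulmxA.
rewrite vec_mul /loading -[RHS]mulmxA; congr (_ *m _).
apply/colP => i; rewrite mul_diag_mx mul_mx_diag mul_diag_mx !mxE.
by rewrite -mulrA mulrCA; congr (_ * _); apply: mulrC.
Qed.

Lemma diag_vec_delta i j :
  diag_mx (vec S)^T *m kron2 (e i) (e j) = S i j *: kron2 (e i) (e j).
Proof.
apply/colP => k; rewrite mul_diag_mx /kron2 -delta_tens !mxE eqxx andbT.
case: eqVneq => [->|_]; last by rewrite !mulr0.
by rewrite mxtens_indexK /= weight_sym.
Qed.

Lemma loading_delta i j : loading *m kron2 (e i) (e j) = S i j *: kron2 (a i) (a j).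
Proof. by rewrite /loading -mulmxA diag_vec_delta -scalemxAr mul_kron2 -!colE. Qed.

Lemma sigma2_loading : sigma F n 2 *m loading = loading *m sigma F n 2.
Proof.
apply: kron2_ext => i j; rewrite -(mulmxA _ loading) loading_delta.
rewrite -(mulmxA loading) -scalemxAr !sigma2E.
rewrite -scalemxAr mulmxDr !loading_delta (weight_sym j i) -scalerDr.
by rewrite !scalerA mulrC.
Qed.

Lemma sigma22_loading2 : sigma22 F n *m loading2 = loading2 *m sigma22 F n.
Proof. exact/sigma22_natural/sigma2_loading. Qed.

Lemma loading2_delta i j k l :
  loading2 *m kron22 (e i) (e j) (e k) (e l) =
  (S i j * S k l) *: kron22 (a i) (a j) (a k) (a l).
Proof.
rewrite /loading2 [LHS](tensmx_mul loading loading (kron2 _ _) (kron2 _ _)).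
by rewrite !loading_delta tensZl linearZ /= scalerA.
Qed.

Hypothesis unitA : A \in unitmx.

Lemma mul_trmx_dual i : A^T *m col i (invmx A)^T = e i.
Proof. by rewrite colE mulmxA -trmx_mul mulVmx // trmx1 mul1mx. Qed.

Lemma dot_dual i j : dot (a i) (col j (invmx A)^T) = (i == j)%:R.
Proof.
rewrite [a i]colE dotC dot_mul mul_trmx_dual dot_delta mxE eqxx andbT.
by rewrite eq_sym.
Qed.

(** Transposed, the loading acts diagonally from the dual basis of the columns
    of A to the standard basis. *)
Lemma trmx_loading2_dual i j k l : let b i := col i (invmx A)^T in
  loading2^T *m kron22 (b i) (b j) (b k) (b l) =
  (S i j * S k l) *: kron22 (e i) (e j) (e k) (e l).
Proof.
move=> b; rewrite /loading2 trmx_tens.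
have dual p q : loading^T *m kron2 (b p) (b q) = S p q *: kron2 (e p) (e q).
  rewrite /loading trmx_mul tr_diag_mx trmx_tens -mulmxA mul_kron2 !mul_trmx_dual //.
  exact: diag_vec_delta.
rewrite [LHS](tensmx_mul loading^T loading^T (kron2 _ _) (kron2 _ _)).
by rewrite !dual tensZl linearZ /= scalerA.
Qed.

Hypothesis weight_neq0 : forall i j, S i j != 0.

Lemma loading_unit : loading \in unitmx.
Proof.
rewrite unitmx_mul; apply/andP; split.
  exact: tens_unit.
rewrite unitmxE det_diag unitfE; apply/prodf_neq0 => k _.
by rewrite !mxE weight_neq0.
Qed.

Lemma loading2_unit : loading2 \in unitmx.
Proof. exact: tens_unit loading_unit loading_unit. Qed.

End Loading.

(** * The symmetrized left kernel of Phi *)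

Section KernelSpace.
Variables (F : numFieldType) (n K : nat) (A S : 'M[F]_n) (G : 'M[F]_(n, K)).
Hypothesis weightT : S^T = S.
Hypothesis unitA : A \in unitmx.
Hypothesis weight_neq0 : forall i j, S i j != 0.
Local Notation e i := (delta_mx i ord0 : 'cV[F]_n).
Local Notation a i := (col i A).
Local Notation B := (invmx A)^T.
Local Notation b i := (col i B).
Local Notation T := (dedicom A S G).
Local Notation G4 := (G \odot G \odot G \odot G : 'M_(n ^ 4, K)).
Local Notation V := (mx_img (sigma22 F n) (left_ker (Phi T))).

Lemma col_odot4 k : col k G4 = kron4 (col k G) (col k G) (col k G) (col k G).
Proof. by rewrite !col_odot. Qed.

Lemma sigma4_odot4 : G4 = sigma F n 4 *m G4.
Proof.
apply: eq_cols => k.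
by rewrite [RHS]colE -mulmxA -colE col_odot4 (sigma_kron_const 4).
Qed.

Lemma col_Phi k : col k (Phi T) =
  loading2 A S *m kron22 (col k G) (col k G) (col k G) (col k G).
Proof.
have -> : col k (Phi T) = vec (T k) *t vec (T k) :> 'cV_(n ^ 2 * n ^ 2).
  by apply/colP => i; rewrite [LHS]mxE [LHS]mxE.
rewrite vec_dedicom; set g := col k G.
exact: (esym (tensmx_mul (loading A S) (loading A S) (kron2 g g) (kron2 g g))).
Qed.

Lemma Phi_factor : Phi T = loading2 A S *m ((regroup F n)^T *m G4).
Proof.
apply: eq_cols => k; rewrite col_Phi [RHS]colE -2!mulmxA -colE col_odot4.
by rewrite -regroup_kron22 (mulmxA _ (regroup F n)) trmx_regroupK mul1mx.
Qed.

Lemma rank_Phi : \rank (Phi T) = \rank G4.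
Proof.
rewrite Phi_factor rank_unit_mul ?loading2_unit //.
apply/eqP; rewrite eqn_leq mxrankM_maxr /=.
by rewrite -{1}[G4]mul1mx -regroupK -mulmxA mxrankM_maxr.
Qed.

Lemma sigma22_Phi : sigma22 F n *m Phi T = Phi T.
Proof.
apply: eq_cols => k; rewrite colE -mulmxA -colE col_Phi mulmxA.
by rewrite sigma22_loading2 // -mulmxA sigma22_diag.
Qed.

Lemma dim_kernel_space : (\dim V + \rank G4 = 'C('C(n.+1, 2).+1, 2))%N.
Proof.
rewrite -rank_Phi -(rank_sigma22 F n).
by rewrite -(dim_img_left_ker (trmx_sigma22 F n) sigma22_Phi).
Qed.

Lemma mem_kernel_space v :
  v \in V -> sigma22 F n *m v = v /\ forall x, dot v (Phi T *m x) = 0.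
Proof.
case/memv_mx_imgP => u /left_kerP kerPhi ->; split.
  by rewrite mulmxA sigma22_idem.
by move=> x; rewrite dotC dot_mul trmx_sigma22 mulmxA sigma22_Phi dotC.
Qed.

(** Paired with a column of Phi, both terms of the combination u below give
    the monomial g_i g_j g_k g_l, which does not see how the indices pair up, so
    u is in the left kernel of Phi. The full symmetrization identifies the two
    tensors in u and leaves the difference of their coefficients. *)
Lemma exchange_kernel_space i j k l :
  exists2 v, v \in V & sigma F n 4 *m (regroup F n *m v) =
    ((S i j * S k l)^-1 - (S i k * S j l)^-1)
      *: (sigma F n 4 *m kron4 (b i) (b j) (b k) (b l)).
Proof.
pose u := (S i j * S k l)^-1 *: kron22 (b i) (b j) (b k) (b l)
        - (S i k * S j l)^-1 *: kron22 (b i) (b k) (b j) (b l).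
exists (sigma22 F n *m u); last first.
  rewrite mulmxA mulmxA sigma4_regroup_sigma22 -mulmxA /u !mulmxBr -!scalemxAr.
  by rewrite !regroup_kron22 (sigma4_swap23 (b i) (b k)) scalerBl.
apply/memv_mx_imgP; exists u => //; apply/left_kerP => x.
rewrite Phi_factor -mulmxA dot_mul /u mulmxBr -!scalemxAr.
rewrite !trmx_loading2_dual // !scalerA !mulVf ?mulf_neq0 // !scale1r.
rewrite -mulmxA dot_mul trmxK mulmxBr !regroup_kron22 sigma4_odot4 -mulmxA dot_sigma.
by rewrite mulmxBr (sigma4_swap23 (e i) (e k)) subrr dotC linear0.
Qed.

Hypothesis rankG4 : \rank G4 = 'C(n + 3, 4).

(** By the rank assumption the columns of the fourth Khatri-Rao power of G span
    all symmetric tensors, so orthogonality to these columns is orthogonality to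
    the range of the symmetrizer. *)
Lemma sigma4_kernel_space v :
  v \in V -> sigma F n 4 *m (regroup F n *m ((loading2 A S)^T *m v)) = 0.
Proof.
case/mem_kernel_space => _ kerPhi.
have [Y SY] : exists Y, sigma F n 4 = G4 *m Y.
  by apply: same_range_factor sigma4_odot4 _; rewrite rankG4 rank_sigma.
apply: dot_ext => y; rewrite linear0 dot_sigma SY -mulmxA.
rewrite !dot_mul trmxK dotC.
by have := kerPhi (Y *m y); rewrite Phi_factor -!mulmxA.
Qed.

(** The standard coordinates of the vanishing symmetrization of
    (loading2 A S)^T v, which is invariant within pairs as v is. *)
Lemma kernel_space_pairings v i j k l : v \in V ->
  S i j * S k l * dot (kron22 (a i) (a j) (a k) (a l)) v
  + S i k * S j l * dot (kron22 (a i) (a k) (a j) (a l)) v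
  + S i l * S j k * dot (kron22 (a i) (a l) (a j) (a k)) v = 0.
Proof.
move=> vV; have [vE _] := mem_kernel_space vV.
have zE : sigma22 F n *m ((loading2 A S)^T *m v) = (loading2 A S)^T *m v.
  have comm : sigma22 F n *m (loading2 A S)^T = (loading2 A S)^T *m sigma22 F n.
    apply: trmx_inj; rewrite (trmx_mul (sigma22 F n)) (trmx_mul _ (sigma22 F n)).
    by rewrite trmxK trmx_sigma22 sigma22_loading2.
  by rewrite mulmxA comm -mulmxA vE.
have := dot_sigma4_pairings (e i) (e j) (e k) (e l) zE.
rewrite sigma4_kernel_space // linear0 => /esym/eqP.
rewrite mulf_eq0 invr_eq0 pnatr_eq0 /= => /eqP.
by rewrite !dot_mul !trmxK !loading2_delta // !dotZl.
Qed.

(** Where the weights of the three pairings agree, the relation between them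
    becomes the vanishing of the full symmetrization. *)
Lemma kernel_space_balanced v i j k l : v \in V ->
  S i j * S k l = S i k * S j l -> S i j * S k l = S i l * S j k ->
  dot (kron4 (a i) (a j) (a k) (a l)) (sigma F n 4 *m (regroup F n *m v)) = 0.
Proof.
move=> vV eqk eql; have [vE _] := mem_kernel_space vV.
rewrite dot_sigma4_pairings //; have := kernel_space_pairings i j k l vV.
rewrite -eqk -eql -!mulrDr => /eqP; rewrite !mulf_eq0.
rewrite !(negPf (weight_neq0 _ _)) /=.
by move/eqP->; rewrite mulr0.
Qed.

End KernelSpace.

(** * Contractions of the symmetrized kernel *)

Section Contractions.
Variables (F : numFieldType) (n K : nat) (A S : 'M[F]_n) (G : 'M[F]_(n, K)).
Hypothesis weightT : S^T = S.
Hypothesis unitA : A \in unitmx.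
Hypothesis weight_neq0 : forall i j, S i j != 0.
Hypothesis rankG4 : \rank (G \odot G \odot G \odot G) = 'C(n + 3, 4).
Local Notation a i := (col i A).
Local Notation B := (invmx A)^T.
Local Notation b i := (col i B).
Local Notation A3 := (A \odot A \odot A : 'M_(n ^ 3, n)).
Local Notation V := (mx_img (sigma22 F n) (left_ker (Phi (dedicom A S G)))).

Variables (N : nat) (p : N.-tuple 'cV[F]_(n ^ 2 * n ^ 2)).
Variable P : 'I_N -> 'M[F]_(n ^ 3, n).
Hypothesis span_p : <<p>>%VS = V.
Hypothesis vecP : forall i,
  vec (P i) = sigma F n 4 *m (regroup F n *m tnth p i).
Local Notation Psym := (\mxrow_(i < N) P i).
Local Notation W := (mx_img (sigma F n 3) (left_ker Psym)).

(** By dot_vec the entries of u^T P_i are the pairings of the symmetrized p_i with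
    x *t u, and the p_i span V. *)
Lemma left_ker_PsymP (u : 'cV_(n ^ 3)) :
  (forall v, v \in V -> forall x : 'cV_n, dot (x *t u : 'cV_(n ^ 4))
      (sigma F n 4 *m (regroup F n *m v)) = 0) <-> u \in left_ker Psym.
Proof.
split=> [contr|/left_ker_mxrowP contr v vV x].
  apply/left_ker_mxrowP => i x; rewrite -dot_vec vecP contr //.
  by rewrite -span_p memv_span ?mem_tnth.
rewrite -span_p in vV; rewrite (coord_span vV) !mulmx_sumr linear_sum big1 // => i _.
by rewrite -!scalemxAr linearZ /= -tnth_nth -vecP dot_vec contr mulr0.
Qed.

Lemma dot_sigma_absorb (x : 'cV[F]_n) (u : 'cV_(n ^ 3)) (v : 'cV_(n ^ 4)) :
  dot (x *t (sigma F n 3 *m u) : 'cV_(n ^ 4)) (sigma F n 4 *m v) =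
  dot (x *t u : 'cV_(n ^ 4)) (sigma F n 4 *m v).
Proof. by rewrite dot_sigma sigma_absorb -dot_sigma. Qed.

Lemma sigma3_Psym : sigma F n 3 *m Psym = Psym.
Proof.
rewrite mul_mxrow; apply: eq_mxrow => i; apply: eq_cols => k; rewrite !colE -mulmxA.
apply: dot_ext => u; rewrite dot_sigma -!dot_vec vecP.
exact: dot_sigma_absorb.
Qed.

(** The contractions of a symmetric tensor are symmetric, so lker Psym contains
    the kernel of the symmetrizer. *)
Lemma dim_sym_ker : (\dim W + \rank Psym = 'C(n + 2, 3))%N.
Proof. by rewrite (dim_img_left_ker (trmx_sigma F n 3) sigma3_Psym) rank_sigma. Qed.

Lemma mem_sym_ker w : w \in W <-> w \in left_ker Psym /\ sigma F n 3 *m w = w.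
Proof.
split=> [/memv_mx_imgP[u /left_kerP uP ->]|[wP wE]]; last first.
  by apply/memv_mx_imgP; exists w.
rewrite mulmxA sigma_idem; split=> //; apply/left_kerP => x.
by rewrite -dot_sigma mulmxA sigma3_Psym.
Qed.

Lemma mem_left_ker_Psym_basis (u : 'cV_(n ^ 3)) :
  (forall v, v \in V -> forall l, dot (a l *t u : 'cV_(n ^ 4))
      (sigma F n 4 *m (regroup F n *m v)) = 0) -> u \in left_ker Psym.
Proof.
move=> contr; apply/left_ker_PsymP => v vV x.
rewrite -[x]mul1mx -(mulmxV unitA) -mulmxA (mulmx_cols A).
rewrite tens_suml dot_suml big1 // => k _.
by rewrite tensZl dotZl contr ?mulr0.
Qed.

Lemma dot_kron3 (x y z x' y' z' : 'cV[F]_n) :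
  dot (kron3 x y z) (kron3 x' y' z') = dot x x' * (dot y y' * dot z z').
Proof. by rewrite [LHS]dot_tens [dot (kron2 _ _) _]dot_tens. Qed.

Lemma col_cubes k : col k A3 = kron3 (a k) (a k) (a k).
Proof. by rewrite !col_odot. Qed.

Lemma dot_dual_cubes i j k c :
  dot (kron3 (b i) (b j) (b k)) (A3 *m c) = ((i == j) && (j == k))%:R * c i ord0.
Proof.
rewrite mulmx_cols linear_sum (bigD1 i) //= big1 => [|m mi].
  rewrite addr0 linearZ /= col_cubes dot_kron3 !(dotC (b _)) !dot_dual // eqxx.
  rewrite mul1r -natrM.
  rewrite mulnb mulrC; congr (_%:R * _).
  by case: (i == j) / eqP => // ->.
by rewrite linearZ /= col_cubes dot_kron3 dotC dot_dual // (negPf mi) mul0r mulr0.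
Qed.

(** The products of vectors of the dual basis form a basis. *)
Lemma kron3_dual_ext (v w : 'cV[F]_(n ^ 3)) :
  (forall i j k, dot (kron3 (b i) (b j) (b k)) v = dot (kron3 (b i) (b j) (b k)) w) ->
  v = w.
Proof.
move=> vw; pose U : 'M_(n ^ 3) := B *t (B *t B).
have unitU : U^T \in unitmx.
  by rewrite unitmx_tr; do 2?apply: tens_unit; rewrite unitmx_tr unitmx_inv.
rewrite -(mulKmx unitU v) -(mulKmx unitU w); congr (_ *m _).
apply/colP => q; rewrite -!dot_delta !dot_mul trmxK.
case: (@mxtens_indexP n (n ^ 2) q) => i q'; case: (@mxtens_indexP n n q') => j k.
rewrite !delta_tens.
by have := vw i j k; rewrite ![b _]colE -mul_kron3.
Qed.

Lemma rank_cubes : \rank A3 = n.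
Proof.
have inv : (B \odot B \odot B : 'M_(n ^ 3, n))^T *m A3 = 1%:M.
  apply/matrixP => i j.
  have -> (M N' : 'M[F]_(n ^ 3, n)) : (M^T *m N') i j = dot (col i M) (col j N').
    by rewrite /dot !mxE; apply: eq_bigr => k _; rewrite !mxE.
  rewrite [col j _]colE 2!col_odot -[_ *t _]/(kron3 (b i) (b i) (b i)).
  rewrite dot_dual_cubes !eqxx mul1r.
  by rewrite !mxE andbT.
apply/eqP; rewrite eqn_leq rank_leq_col /=.
by have := mxrankM_maxr (B \odot B \odot B : 'M_(n ^ 3, n))^T A3; rewrite inv mxrank1.
Qed.

(** For the indices l, k, k, k all three pairings have the weight S_lk S_kk. *)
Lemma cubes_sub_sym_ker : (range_mx A3 <= W)%VS.
Proof.
rewrite -span_cols; apply/span_subvP => _ /mapP[k _ ->].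
rewrite col_cubes; apply/mem_sym_ker; split; last exact: (sigma_kron_const 3).
apply: mem_left_ker_Psym_basis => v vV l.
exact: (kernel_space_balanced (l := k) weightT weight_neq0 rankG4 vV).
Qed.

(** If column j of S is c times column k, all three pairings of l, j, j, k have
    the same weight, so the symmetrization of a_j, a_j, a_k joins the cubes. *)
Lemma sym_ker_not_sub_cubes j k c :
  j != k -> col j S = c *: col k S -> ~~ (W <= range_mx A3)%VS.
Proof.
move=> jk jkS; have SE l : S l j = c * S l k.
  by have /colP/(_ l) := jkS; rewrite !mxE.
pose u := sigma F n 3 *m kron3 (a j) (a j) (a k).
have uW : u \in W.
  apply/mem_sym_ker; split; last by rewrite mulmxA sigma_idem.
  apply: mem_left_ker_Psym_basis => v vV l.
  rewrite dot_sigma sigma_absorb -dot_sigma.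
  have weights : S l j * S j k = S l k * S j j by rewrite !SE mulrAC mulrA mulrC mulrA.
  exact: (kernel_space_balanced weightT weight_neq0 rankG4 vV).
apply/negP => /subvP/(_ u uW)/memv_mx_imgP[d _ uE].
have := dot_dual_cubes j j k d; rewrite -uE (negPf jk) andbF mul0r.
have dE x y z : dot (kron3 (b j) (b j) (b k)) (a x *t kron2 (a y) (a z) : 'cV_(n ^ 3)) =
    (x == j)%:R * ((y == j)%:R * (z == k)%:R).
  by rewrite [LHS]dot_kron3 !(dotC (b _)) !dot_dual.
rewrite /u sigma3E !sigma2E !linearZ /= !linearD /= !linearZ /= !dE.
rewrite !eqxx (eq_sym k) (negPf jk) !(mulr1, mulr0, mul0r, addr0).
move/eqP; rewrite mulf_eq0 -mulr2n mulrn_eq0 !invr_eq0 !pnatr_eq0; exact/negP.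
Qed.

(** Contracting sigma4 (b_i, b_j, b_k, b_l) with a_l gives a positive multiple
    of the symmetrization of b_i, b_j, b_k, because w pairs equally with all
    orders of these three. *)
Lemma sym_ker_orthogonal w i j k l : w \in W -> S i j * S k l != S i k * S j l ->
  dot (kron3 (b i) (b j) (b k)) w = 0.
Proof.
move=> /mem_sym_ker[/left_ker_PsymP contr wE] neq.
have [v vV vE] := exchange_kernel_space G weightT unitA weight_neq0 i j k l.
have := contr v vV (a l); rewrite vE linearZ /= => /eqP.
rewrite mulf_eq0 subr_eq0 (inj_eq invr_inj) (negPf neq) /= sigma4E linearZ /=.
rewrite mulf_eq0 invr_eq0 pnatr_eq0 /= !linearD /= !dot_tens !dot_dual //.
have -> : dot (kron3 (b i) (b j) (b k)) w =
    dot w (sigma F n 3 *m kron3 (b i) (b j) (b k)).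
  by rewrite dot_sigma wE dotC.
set d := dot w (sigma F n 3 *m kron3 (b i) (b j) (b k)).
have -> : (l == i)%:R * dot w (sigma F n 3 *m kron3 (b j) (b k) (b l)) = (l == i)%:R * d.
  by case: eqVneq => [->|_]; rewrite ?mul0r // sigma3_swap23 sigma3_swap12.
have -> : (l == j)%:R * dot w (sigma F n 3 *m kron3 (b i) (b k) (b l)) = (l == j)%:R * d.
  by case: eqVneq => [->|_]; rewrite ?mul0r // sigma3_swap23.
have -> : (l == k)%:R * dot w (sigma F n 3 *m kron3 (b j) (b i) (b l)) = (l == k)%:R * d.
  by case: eqVneq => [->|_]; rewrite ?mul0r // sigma3_swap12.
rewrite eqxx sigma3_swap23 sigma3_swap12 -/d -!mulrDl -!natrD mulf_eq0 pnatr_eq0.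
by rewrite addn1 /= => /eqP.
Qed.

(** If S_ij S_kl = S_ik S_jl held for every l, columns j and k of S would be
    proportional, with ratio S_ij / S_ik. *)
Lemma sym_ker_off_diagonal w i j k :
  (forall c, col j S != c *: col k S) -> w \in W ->
  dot (kron3 (b i) (b j) (b k)) w = 0.
Proof.
move=> indep wW.
have [/forallP allE|] := boolP [forall l, S i j * S k l == S i k * S j l].
  case/eqP: (indep (S i j / S i k)); apply/colP => l; rewrite !mxE.
  apply: (mulfI (weight_neq0 i k)); rewrite [S l j]weight_sym // -(eqP (allE l)).
  by rewrite mulrA mulrCA mulfV ?mulr1 // [S l k]weight_sym.
by rewrite negb_forall => /existsP[l]; apply: sym_ker_orthogonal.
Qed.

(** The element w agrees with the combination of cubes that has its diagonal
    coordinates, because its other coordinates vanish. *)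
Lemma sym_ker_sub_cubes :
  (forall j k, j != k -> forall c, col j S != c *: col k S) ->
  (W <= range_mx A3)%VS.
Proof.
move=> indep; apply/subvP => w wW; apply/memv_mx_imgP.
exists (\col_m dot (kron3 (b m) (b m) (b m)) w); first exact: memvf.
apply: kron3_dual_ext => i j k; rewrite dot_dual_cubes mxE.
have [<-|ij] := eqVneq i j.
  have [<-|jk] := eqVneq i k; first by rewrite mul1r.
  by rewrite mul0r (sym_ker_off_diagonal _ (indep _ _ jk)).
have [_ wE] := (mem_sym_ker w).1 wW.
have -> : dot (kron3 (b i) (b j) (b k)) w = dot (kron3 (b k) (b i) (b j)) w.
  by rewrite -{1}wE dot_sigma sigma3_swap23 sigma3_swap12 -dot_sigma wE.
by rewrite mul0r (sym_ker_off_diagonal _ (indep _ _ ij)).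
Qed.

End Contractions.

(** * The rank of Psym *)

(** The symmetric square of the symmetric square of an n-dimensional space is
    its symmetric fourth power plus the space of algebraic curvature tensors,
    whose dimension is the quotient by 12. *)
Lemma binom_count n : (2 <= n)%N ->
  ('C('C(n.+1, 2).+1, 2) = (n ^ 2 * (n - 1) * (n + 1)) %/ 12 + 'C(n + 3, 4))%N.
Proof.
move=> n_ge2.
have c2 m : ('C(m.+1, 2) * 2 = m.+1 * m)%N by rewrite bin_ffact !ffactnS ffactn0 /= muln1.
have c4 : ('C(n + 3, 4) * 24 = (n + 3) * ((n + 2) * ((n + 1) * n)))%N.
  by rewrite -[24%N]/(4`!)%N bin_ffact !addnS addn0 !ffactnS ffactn0 /= muln1.
have {}c2 := (c2 n, c2 'C(n.+1, 2)%N).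
move: c2.1 c2.2 c4 => {c2}; move: 'C(n.+1, 2)%N 'C(n + 3, 4)%N => x y.
move: 'C(x.+1, 2)%N => z xE zE yE.
case: n n_ge2 xE yE => [//|m] _ xE yE.
have E : (m.+1 ^ 2 * (m.+1 - 1) * (m.+1 + 1) = (z - y) * 12)%N.
  rewrite subn1 /=. rewrite expnS expn1.
  have zE4 : (z * 8 = m.+2 * m.+1 * (m.+2 * m.+1 + 2))%N by nia.
  have le : (y <= z)%N by nia.
  nia.
rewrite E mulnK //. nia.
Qed.

Theorem theorem6p4 (RR : realType) (R K : nat) (T : 'I_K -> 'M[RR]_R)
    (A F : 'M[RR]_R) (G : 'M[RR]_(R, K)) :
  (2 <= R)%N ->
  F^T = F ->
  T = dedicom A F G ->
  \rank A = R ->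
  (forall i j, F i j != 0) ->
  \rank (G \odot G \odot G \odot G) = 'C(R + 3, 4) ->
  let N := ((R ^ 2 * (R - 1) * (R + 1)) %/ 12)%N in
  let V := mx_img (sigma22 RR R) (left_ker (Phi T)) in
  \dim V = N /\
  forall (p : N.-tuple 'cV[RR]_(R ^ 2 * R ^ 2))
         (P : 'I_N -> 'M[RR]_(R ^ 3, R)),
    basis_of V p ->
    (forall n, vec (P n) =
       sigma RR R 4 *m castmx (expn22 R, erefl 1%N) (tnth p n)) ->
    let Psym := \mxrow_(n < N) P n in
    [/\ (\rank Psym <= 'C(R + 2, 3) - R)%N,
        \rank Psym = ('C(R + 2, 3) - R)%N <->
          (2 <= krank F)%N /\ (2 <= krank F^T)%N
      & (2 <= krank F)%N /\ (2 <= krank F^T)%N ->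
        mx_img (sigma RR R 3) (left_ker Psym) =
          <<[seq (col k A *t (col k A *t col k A) : 'cV_(R ^ 3))
              | k <- enum 'I_R]>>%VS /\
        <<[seq (col k A *t (col k A *t col k A) : 'cV_(R ^ 3))
              | k <- enum 'I_R]>>%VS = range_mx (A \odot A \odot A)].
Proof.
move=> R_ge2 symF -> rankA F_neq0 rankG4 N V.
have unitA : A \in unitmx by rewrite -row_free_unit /row_free rankA.
have dimV : \dim V = N.
  apply: (@addIn 'C(R + 3, 4)); rewrite -binom_count // -[in LHS]rankG4.
  exact: dim_kernel_space.
split=> // p P basisV vecP Psym.
have spanV := span_basis basisV.
have {}vecP i : vec (P i) = sigma RR R 4 *m (regroup RR R *m tnth p i).
  by rewrite -regroupE; apply: vecP.
have rankP : (\dim (mx_img (sigma RR R 3) (left_ker Psym)) + \rank Psym = 'C(R + 2, 3))%N.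
  exact: dim_sym_ker vecP.
have cubes : (range_mx (A \odot A \odot A) <= mx_img (sigma RR R 3) (left_ker Psym))%VS.
  exact: (cubes_sub_sym_ker symF unitA F_neq0 rankG4 spanV vecP).
have dim_cubes : \dim (range_mx (A \odot A \odot A)) = R.
  by rewrite dim_range rank_cubes.
have R_le : (R <= \dim (mx_img (sigma RR R 3) (left_ker Psym)))%N.
  by rewrite -[X in (X <= _)%N]dim_cubes dimvS.
have krankP : (2 <= krank F)%N /\ (2 <= krank F^T)%N <->
    (forall j k, j != k -> forall c, col j F != c *: col k F).
  rewrite symF -krank2P //; first by split=> [[]|].
  move=> k; apply/eqP => /colP/(_ k)/eqP; rewrite !mxE; exact/negP/F_neq0.
have spanE : <<[seq (col k A *t (col k A *t col k A) : 'cV_(R ^ 3))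
    | k <- enum 'I_R]>>%VS = range_mx (A \odot A \odot A).
  by rewrite -span_cols; congr <<_>>%VS; apply: eq_map => k; rewrite !col_odot.
split.
- by rewrite -rankP -addnBAC // leq_addl.
- rewrite krankP; split=> [rankE j k jk c|indep].
    apply/eqP => jkF.
    have /negP := sym_ker_not_sub_cubes symF unitA F_neq0 rankG4 spanV vecP jk jkF.
    apply; have : range_mx (A \odot A \odot A) == mx_img (sigma RR R 3) (left_ker Psym).
      rewrite eqEdim cubes dim_cubes /=; move: rankP R_le; rewrite rankE.
      by move: (\dim _) ('C(_, _)) => d m; lia.
    by move/eqP=> ->.
  rewrite -rankP; have -> : \dim (mx_img (sigma RR R 3) (left_ker Psym)) = R.
    apply/eqP; rewrite eqn_leq R_le andbT -[X in (_ <= X)%N]dim_cubes dimvS //.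
    exact: (sym_ker_sub_cubes symF unitA F_neq0 spanV vecP indep).
  by rewrite addKn.
move=> /krankP indep; split=> //; rewrite spanE; apply/eqP; rewrite eqEsubv cubes andbT.
exact: (sym_ker_sub_cubes symF unitA F_neq0 spanV vecP indep).
Qed.
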